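(* There exist universal positive constants $c,c'$ such that the following holds. Let $X=(\mathbf{x}_1,\ldots,\mathbf{x}_n)\in\mathbb{R}^{d\times n}$, $A=\frac1n\sum_{i=1}^n\mathbf{x}_i\mathbf{x}_i^\top$, $r=\max_i\|\mathbf{x}_i\|^2$, and suppose the eigenvalues $s_1>s_2\ge\ldots\ge s_d$ of $A$ satisfy $s_1-s_2=\lambda$ with $\lambda>0$; let $\mathbf{v}_1$ be a unit leading eigenvector of $A$. For any $\delta\in(0,\frac12)$, suppose vector VR-PCA (defined in the context) is run with some initial unit-norm vector $\tilde{\mathbf{w}}_0$ such that $$\langle\mathbf{v}_1,\tilde{\mathbf{w}}_0\rangle^2\ge\zeta>0,$$ with any epoch length, and with a step size $\eta>0$ satisfying $$\eta\le\frac{c\,\delta^2\lambda\zeta^3}{r^2\log^2(2/\delta)}.$$ Then with probability at least $1-\delta$, after $$T=\left\lfloor\frac{c'\log(2/\delta)}{\eta\lambda\zeta}\right\rfloor$$ stochastic iterations we get a point $\mathbf{w}_T$ satisfying $1-\langle\mathbf{v}_1,\mathbf{w}_T\rangle^2\le\frac12$. Moreover, if $\eta$ is chosen on the same order as the upper bound $\frac{c\,\delta^2\lambda\zeta^3}{r^2\log^2(2/\delta)}$, then $$T=\Theta\left(\frac{r^2\log^3(2/\delta)}{\delta^2\lambda^2\zeta^4}\right).$$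
   Context: Vector VR-PCA. Parameters: step size $\eta$, epoch length $m$ (a positive integer). Input: $X=(\mathbf{x}_1,\ldots,\mathbf{x}_n)$ and a unit vector $\tilde{\mathbf{w}}_0\in\mathbb{R}^d$. For each epoch $s=1,2,\ldots$: set $\tilde{\mathbf{u}}=\frac1n\sum_{i=1}^n\mathbf{x}_i(\mathbf{x}_i^\top\tilde{\mathbf{w}}_{s-1})$ and $\mathbf{w}_0=\tilde{\mathbf{w}}_{s-1}$; for $t=1,\ldots,m$ perform a stochastic iteration: draw $i_t\in\{1,\ldots,n\}$ uniformly at random, independently of the past, and set $$\mathbf{w}'_t=\mathbf{w}_{t-1}+\eta\left(\mathbf{x}_{i_t}\left(\mathbf{x}_{i_t}^\top\mathbf{w}_{t-1}-\mathbf{x}_{i_t}^\top\tilde{\mathbf{w}}_{s-1}\right)+\tilde{\mathbf{u}}\right),\qquad \mathbf{w}_t=\mathbf{w}'_t/\|\mathbf{w}'_t\|;$$ finally set $\tilde{\mathbf{w}}_s=\mathbf{w}_m$. In the theorem, stochastic iterations are counted consecutively across all epochs, and $\mathbf{w}_T$ denotes the iterate obtained after $T$ stochastic iterations in total (so a single running index $\mathbf{w}_0=\tilde{\mathbf{w}}_0,\mathbf{w}_1,\mathbf{w}_2,\ldots$ is used, not restarted at each epoch). The probability is over the random draws of the indices; $\log$ is the natural logarithm. *)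

(* Defs.v *)
From HB Require Import structures.
From mathcomp Require Import all_boot all_order all_algebra finmap.
From mathcomp Require Import all_classical all_reals all_analysis.

Set Implicit Arguments.
Unset Strict Implicit.
Unset Printing Implicit Defensive.

Import Order.TTheory GRing.Theory Num.Theory.
Import numFieldNormedType.Exports.

Local Open Scope classical_set_scope.
Local Open Scope ring_scope.

(* The library norm of a matrix is the sup norm, so the Euclidean structure on
   column vectors is introduced separately. *)
Definition inner (R : realType) (d : nat) (u v : 'cV[R]_d) : R :=
  (u^T *m v) 0 0.

Definition l2norm (R : realType) (d : nat) (u : 'cV[R]_d) : R :=
  Num.sqrt (inner u u).

(* The data points are the columns of X. *)
Definition covariance_mx (R : realType) (d n : nat) (X : 'M[R]_(d, n))
  : 'M[R]_d :=
  n%:R^-1 *: \sum_(i < n) (col i X *m (col i X)^T).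

(* The squared norms are nonnegative, so the default value 0 is harmless as soon
   as n > 0. *)
Definition max_sqnorm (R : realType) (d n : nat) (X : 'M[R]_(d, n)) : R :=
  \big[Num.max/0]_(i < n) l2norm (col i X) ^+ 2.

(* s lists the eigenvalues of A with multiplicity, in nonincreasing order. *)
Definition ordered_spectrum (R : realType) (d : nat) (A : 'M[R]_d)
    (s : seq R) : Prop :=
  sorted >=%R s /\ char_poly A = \prod_(z <- s) ('X - z%:P).

Definition vrpca_step (R : realType) (d n : nat) (X : 'M[R]_(d, n)) (eta : R)
    (wt : 'cV[R]_d) (i : 'I_n) (w : 'cV[R]_d) : 'cV[R]_d :=
  let x := col i X in
  let ut := n%:R^-1 *: \sum_(j < n) (inner (col j X) wt *: col j X) in
  let w' := w + eta *: ((inner x w - inner x wt) *: x + ut) in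
  (l2norm w')^-1 *: w'.

(* t steps inside one epoch with reference point wt; step number k + 1 of the
   epoch uses the draw i k. *)
Fixpoint vrpca_inner (R : realType) (d n : nat) (X : 'M[R]_(d, n)) (eta : R)
    (wt : 'cV[R]_d) (i : nat -> 'I_n) (t : nat) : 'cV[R]_d :=
  if t is t'.+1 then vrpca_step X eta wt (i t') (vrpca_inner X eta wt i t')
  else wt.

(* The draws of all epochs form one sequence i, epoch number s + 1 consuming
   i (s * m), ..., i (s * m + m - 1). *)
Fixpoint vrpca_epoch (R : realType) (d n : nat) (X : 'M[R]_(d, n)) (eta : R)
    (m : nat) (w0 : 'cV[R]_d) (i : nat -> 'I_n) (s : nat) : 'cV[R]_d :=
  if s is s'.+1 then
    vrpca_inner X eta (vrpca_epoch X eta m w0 i s')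
      (fun t => i (s' * m + t)%N) m
  else w0.

(* The iterate after T stochastic iterations in total: T %/ m complete epochs
   followed by T %% m iterations of the next one. *)
Definition vrpca (R : realType) (d n : nat) (X : 'M[R]_(d, n)) (eta : R)
    (m : nat) (w0 : 'cV[R]_d) (i : nat -> 'I_n) (T : nat) : 'cV[R]_d :=
  vrpca_inner X eta (vrpca_epoch X eta m w0 i (T %/ m))
    (fun t => i (T %/ m * m + t)%N) (T %% m).

(* Random indices that are uniform on 'I_n and mutually independent. *)
Definition iid_uniform_draws (R : realType) (disp : measure_display)
    (Omega : measurableType disp) (P : probability Omega R) (n : nat)
    (I : nat -> Omega -> 'I_n) : Prop :=
  [/\ forall t (j : 'I_n), measurable (I t @^-1` [set j]),
      forall t (j : 'I_n), P (I t @^-1` [set j]) = (n%:R^-1)%:E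
    & forall (J : {fset nat}) (B : nat -> set 'I_n),
        P (\bigcap_(t in [set` J]) (I t @^-1` B t))
        = (\prod_(t <- J) P (I t @^-1` B t))%E].

Definition step_bound (R : realType) (c r lambda zeta delta : R) : R :=
  c * delta ^+ 2 * lambda * zeta ^+ 3 / (r ^+ 2 * ln (2 / delta) ^+ 2).

Definition iteration_count (R : realType) (c' eta lambda zeta delta : R) : nat :=
  Num.truncn (c' * ln (2 / delta) / (eta * lambda * zeta)).

(* If d were 1, s`_1 would be the default value 0 and not an eigenvalue. *)
Definition vrpca_hyps (R : realType) (d n : nat) (X : 'M[R]_(d, n))
    (s : seq R) (lambda : R) (v1 w0 : 'cV[R]_d) (zeta delta : R) (m : nat)
    (c eta : R) : Prop :=
  [/\ (1 < d)%N /\ (0 < n)%N,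
      ordered_spectrum (covariance_mx X) s,
      s`_0 - s`_1 = lambda /\ 0 < lambda,
      covariance_mx X *m v1 = s`_0 *: v1 /\ l2norm v1 = 1
    & [/\ l2norm w0 = 1, 0 < zeta <= inner v1 w0 ^+ 2, 0 < delta < 1 / 2,
          (0 < m)%N & 0 < eta <= step_bound c (max_sqnorm X) lambda zeta delta]].

(* Main.v *)
Require Import Defs.
From HB Require Import structures.
From mathcomp Require Import all_boot all_order all_algebra finmap.
From mathcomp Require Import all_classical all_reals all_analysis.
From mathcomp Require Import complex ring lra.

Set Implicit Arguments.
Unset Strict Implicit.
Unset Printing Implicit Defensive.

Import Order.TTheory GRing.Theory Num.Theory.
Import numFieldNormedType.Exports.

Local Open Scope classical_set_scope.
Local Open Scope ring_scope.

(* Write p_t = <v1, w_t>^2. Expanding one normalized step to second order, with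
   a remainder controlled by the boundedness of the stochastic direction, gives
     p_(t+1) >= p_t + 2 eta lambda p_t (1 - p_t) + D_t - 66 (eta r)^2,
   where D_t has mean zero given the past and |D_t| <= 16 eta r: the spectral gap
   produces the logistic drift, and the reference point, being known before the
   draw, enters only through D_t. Over T steps the bias 66 T (eta r)^2 is at most
   zeta / 8, and a second-moment maximal inequality confines the partial sums of
   D_t to [- zeta / 8, zeta / 8] with probability at least 1 - delta. On that
   event p_t stays above zeta / 2, hence the drift is of order eta lambda zeta as
   long as p_t < 7 / 8, which cannot last for T steps; once p_t has reached 7 / 8,
   it cannot fall below 1 / 2. *)

(** * Spectral gap and Rayleigh quotient *)

Lemma char_poly_similar (K : fieldType) d (P B : 'M[K]_d) : P \in unitmx ->
  char_poly (invmx P *m B *m P) = char_poly B.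
Proof.
move=> Pu.
have e : map_mx polyC (invmx P) *m map_mx polyC P = 1%:M.
  by rewrite -map_mxM mulVmx // map_mx1.
have -> : char_poly (invmx P *m B *m P) =
    \det (map_mx polyC (invmx P) *m char_poly_mx B *m map_mx polyC P).
  rewrite /char_poly; congr (\det _).
  rewrite /char_poly_mx mulmxBr mulmxBl scalar_mxC.
  by rewrite -[X in _ = X - _]mulmxA e mulmx1 !map_mxM.
by rewrite !det_mulmx mulrAC -det_mulmx e det1 mul1r.
Qed.

Section Spectral.
Local Open Scope sesquilinear_scope.

Lemma unitary_inner (C : numClosedFieldType) d (P D : 'M[C]_d) (u v : 'cV[C]_d) :
  (u ^t* *m (P ^t* *m D *m P *m v)) 0 0 =
  ((P *m u) ^t* *m (D *m (P *m v))) 0 0.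
Proof. by rewrite trmx_mul map_mxM !mulmxA. Qed.

(** Diagonalize [A] in a unitary eigenbasis. Counted with multiplicity, [a] is the only eigenvalue
    above [b], so it sits at a single coordinate [k]; [v] is supported there, and every other
    coordinate of [w] is weighted by at most [b]. *)
Lemma rayleigh_gap_closed (C : numClosedFieldType) d (A : 'M[C]_d) (a b : C)
    (s : seq C) (v w : 'cV[C]_d) :
  A \is hermsymmx -> char_poly A = \prod_(z <- a :: s) ('X - z%:P) ->
  b < a -> (forall z, z \in s -> z <= b) ->
  A *m v = a *: v -> (v ^t* *m v) 0 0 = 1 -> (w ^t* *m w) 0 0 = 1 ->
  (w ^t* *m (A *m w)) 0 0 <=
  a * `|(v ^t* *m w) 0 0| ^+ 2 + b * (1 - `|(v ^t* *m w) 0 0| ^+ 2).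
Proof.
move=> Ah chA ltba sb Av v1 w1.
have Au := spectral_unitarymx A.
have Aunit := spectral_unit A.
have /hermitian_normalmx/orthomx_spectralP := Ah.
move: Au Aunit; set P := spectralmx A; set D := spectral_diag A => Au Aunit AE.
have iP : invmx P = P ^t* by exact: invmx_unitary.
have PP : P ^t* *m P = 1%:M by rewrite -iP mulVmx.
have chD : \prod_i ('X - (D 0 i)%:P) = \prod_(z <- a :: s) ('X - z%:P).
  rewrite -chA AE char_poly_similar // char_poly_trig ?diag_mx_is_trig //.
  by apply: eq_bigr => i _; rewrite mxE eqxx mulr1n.
have pD : perm_eq [seq D 0 i | i <- enum 'I_d] (a :: s).
  by apply: prod_XsubC_eq; rewrite big_map big_enum.
have [k Dk] : exists k, D 0 k = a.
  have : a \in [seq D 0 i | i <- enum 'I_d] by rewrite (perm_mem pD) mem_head.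
  by case/mapP => k _ ->; exists k.
(* Cancelling one occurrence of [a] on both sides of [pD] leaves the diagonal entries other than [k]
   as a permutation of [s]. *)
have Dj j : j != k -> D 0 j <= b.
  move=> jk; apply: sb.
  have : perm_eq [seq D 0 i | i <- k :: rem k (enum 'I_d)] (a :: s).
    rewrite -(permPr pD); apply: perm_map; rewrite perm_sym perm_to_rem //.
    by rewrite mem_enum.
  rewrite /= Dk perm_cons => /perm_mem <-.
  by apply: map_f; rewrite (mem_rem_uniq) ?enum_uniq // !inE jk mem_enum.
have form (u t : 'cV[C]_d) : (u ^t* *m (A *m t)) 0 0 =
    \sum_j D 0 j * (((P *m u) j 0)^* * (P *m t) j 0).
  rewrite AE iP unitary_inner mxE; apply: eq_bigr => j _.
  rewrite mul_diag_mx !mxE; ring.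
have form1 (u t : 'cV[C]_d) : (u ^t* *m t) 0 0 =
    \sum_j (((P *m u) j 0)^* * (P *m t) j 0).
  have -> : u ^t* *m t = (P *m u) ^t* *m (P *m t).
    by rewrite trmx_mul map_mxM -mulmxA [P^t* *m _]mulmxA PP mul1mx.
  by rewrite mxE; apply: eq_bigr => j _; rewrite !mxE.
have Pv j : j != k -> (P *m v) j 0 = 0.
  move=> jk; have : (P *m (A *m v)) j 0 = a * (P *m v) j 0.
    by rewrite Av -scalemxAr mxE.
  rewrite AE !mulmxA mulmxV // mul1mx -mulmxA mul_diag_mx mxE.
  move/eqP; rewrite -subr_eq0 -mulrBl mulf_eq0 subr_eq0 => /orP[/eqP e|/eqP //].
  by have := le_lt_trans (Dj _ jk) ltba; rewrite e ltxx.
have vw (u : 'cV[C]_d) : (v ^t* *m u) 0 0 = ((P *m v) k 0)^* * (P *m u) k 0.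
  rewrite form1 (bigD1 k) //= big1 ?addr0 // => j jk.
  by rewrite Pv // conjC0 mul0r.
have vk : `|(P *m v) k 0| ^+ 2 = 1 by rewrite normCKC -vw v1.
rewrite vw normrM exprMn norm_conjC vk mul1r form.
have -> : 1 - `|(P *m w) k 0| ^+ 2 = \sum_(j | j != k) `|(P *m w) j 0| ^+ 2.
  rewrite -w1 form1 (bigD1 k) //= -normCKC addrAC subrr add0r.
  by apply: eq_bigr => j _; rewrite normCKC.
rewrite (bigD1 k) //= Dk -normCKC lerD2l mulr_sumr; apply: ler_sum => j jk.
by rewrite -normCKC ler_wpM2r ?exprn_ge0 // Dj.
Qed.
End Spectral.

(** The spectral theorem is applied over [R[i]]: a real symmetric matrix is Hermitian there, and
    both sides of the inequality are images of real numbers. *)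
Lemma rayleigh_gap (R : realType) d (A : 'M[R]_d) (s : seq R) (v w : 'cV[R]_d) :
  (1 < d)%N -> A^T = A -> ordered_spectrum A s -> s`_1 < s`_0 ->
  A *m v = s`_0 *: v -> inner v v = 1 -> inner w w = 1 ->
  inner w (A *m w) <= s`_0 * inner v w ^+ 2 + s`_1 * (1 - inner v w ^+ 2).
Proof.
move=> d1 As [ss chA]; have sz : size s = d.
  by have := size_char_poly A; rewrite chA size_prod_XsubC => -[].
case: s sz ss chA => [|a [|b s]] sz ss chA; first by rewrite -sz in d1.
  by rewrite -sz in d1.
rewrite /inner /= => ltba Av v1 w1.
pose f : {rmorphism R -> R[i]} := real_complex R.
have fJ x : (f x)^* = f x by exact: conjc_real.
have fi (u t : 'cV[R]_d) : f ((u^T *m t) 0 0) =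
    ((map_mx Num.conj (map_mx f u)^T) *m map_mx f t) 0 0.
  rewrite [in RHS]mxE mxE rmorph_sum; apply: eq_bigr => j _.
  by rewrite !mxE rmorphM fJ.
have := @rayleigh_gap_closed _ _ (map_mx f A) (f a) (f b) (map f (b :: s))
  (map_mx f v) (map_mx f w).
rewrite -!map_mxM -!fi.
have real_norm x : `|f x| ^+ 2 = f (x ^+ 2).
  by rewrite normCK fJ -expr2 rmorphXn.
rewrite real_norm.
have -> : f a * f ((v^T *m w) 0 0 ^+ 2) + f b * (1 - f ((v^T *m w) 0 0 ^+ 2)) =
   f (a * (v^T *m w) 0 0 ^+ 2 + b * (1 - (v^T *m w) 0 0 ^+ 2)).
  rewrite rmorphD [in RHS]rmorphM [f (b * _)]rmorphM [f (1 - _)]rmorphB rmorph1.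
  by congr (_ + _).
have fle x y : (f x <= f y) = (x <= y) by exact: lecR.
move=> H; rewrite -fle; apply: H.
- apply: realsym_hermsym.
    apply/eqP; rewrite expr0 scale1r map_mx_id //.
    by apply/matrixP => i j; rewrite !mxE -[in LHS]As mxE.
  by apply/mxOverP => i j; rewrite mxE; apply/complex_realP; exists (A i j).
- have -> : f a :: map f (b :: s) = map f [:: a, b & s] by [].
  rewrite big_map -map_char_poly chA rmorph_prod.
  by apply: eq_bigr => z _; rewrite rmorphB /= map_polyX map_polyC.
- by rewrite ltcR.
- move=> z /mapP[y ys ->]; rewrite fle.
  move: ss => /= /andP[_]; move: ys; rewrite inE => /orP[/eqP -> //|ys].
  by move/(order_path_min (@ge_trans _ _))/allP/(_ _ ys).
- by rewrite Av; apply/matrixP => i j; rewrite !mxE rmorphM.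
- by rewrite v1.
- by rewrite w1.
Qed.

(** * Euclidean inner product on column vectors *)

Lemma innerE (R : realType) d (u v : 'cV[R]_d) :
  inner u v = \sum_i u i 0 * v i 0.
Proof. by rewrite /inner mxE; apply: eq_bigr => i _; rewrite mxE. Qed.

Lemma innerC (R : realType) d (u v : 'cV[R]_d) : inner u v = inner v u.
Proof. by rewrite !innerE; apply: eq_bigr => i _; rewrite mulrC. Qed.

Lemma innerDr (R : realType) d (u v w : 'cV[R]_d) :
  inner u (v + w) = inner u v + inner u w.
Proof. by rewrite /inner mulmxDr mxE. Qed.

Lemma innerZr (R : realType) d (u v : 'cV[R]_d) k :
  inner u (k *: v) = k * inner u v.
Proof. by rewrite /inner -scalemxAr mxE. Qed.

Lemma inner_sumr (R : realType) d n (u : 'cV[R]_d) (F : 'I_n -> 'cV[R]_d) :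
  inner u (\sum_i F i) = \sum_i inner u (F i).
Proof. by rewrite /inner mulmx_sumr summxE. Qed.

Lemma inner_ge0 (R : realType) d (u : 'cV[R]_d) : 0 <= inner u u.
Proof. by rewrite innerE sumr_ge0 // => i _; rewrite -expr2 sqr_ge0. Qed.

Lemma inner_eq0 (R : realType) d (u : 'cV[R]_d) : (inner u u == 0) = (u == 0).
Proof.
apply/eqP/eqP => [|->]; last by rewrite /inner mulmx0 mxE.
rewrite innerE => /eqP.
rewrite psumr_eq0 => [/allP u0|i _]; last by rewrite -expr2 sqr_ge0.
apply/colP => i; rewrite mxE.
by have := u0 i (mem_index_enum _); rewrite /= mulf_eq0 orbb => /eqP.
Qed.

(** Expand the squared norm of [inner u u *: v - inner u v *: u]. *)
Lemma inner_CauchySchwarz (R : realType) d (u v : 'cV[R]_d) :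
  inner u v ^+ 2 <= inner u u * inner v v.
Proof.
have [/eqP|u0] := eqVneq (inner u u) 0.
  rewrite inner_eq0 => /eqP ->.
  have inner0 t : inner (0 : 'cV[R]_d) t = 0.
    by rewrite innerE big1 // => i _; rewrite mxE mul0r.
  by rewrite !inner0 expr0n mul0r.
have upos : 0 < inner u u by rewrite lt_def u0 inner_ge0.
have := inner_ge0 (inner u u *: v + (- inner u v) *: u).
rewrite innerDr !innerZr (innerC _ v) (innerC _ u) !innerDr !innerZr.
rewrite (innerC v u).
set a := inner u u in upos *; set b := inner u v; set c := inner v v.
have -> : a * (a * c + - b * b) + - b * (a * b + - b * a) = a * (a * c - b ^+ 2).
  by ring.
by rewrite pmulr_rge0 // subr_ge0.
Qed.

Lemma l2norm_eq1 (R : realType) d (u : 'cV[R]_d) : l2norm u = 1 <-> inner u u = 1.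
Proof.
rewrite /l2norm; split=> [h|->]; last by rewrite sqrtr1.
by rewrite -(sqr_sqrtr (inner_ge0 u)) h expr1n.
Qed.

Lemma mean_le (R : realFieldType) n (F : 'I_n -> R) B : (0 < n)%N -> (forall i, `|F i| <= B) ->
  `|n%:R^-1 * \sum_i F i| <= B.
Proof.
move=> n0 FB; rewrite normrM ger0_norm ?invr_ge0 ?ler0n //.
rewrite ler_pdivrMl ?ltr0n //; apply: (le_trans (ler_norm_sum _ _ _)).
have -> : n%:R * B = \sum_(i < n) B by rewrite sumr_const card_ord mulr_natl.
exact: ler_sum.
Qed.

(** * Covariance matrix *)

Section Covariance.
Variables (R : realType) (d n : nat) (X : 'M[R]_(d, n)).
Let r := max_sqnorm X.
Let A := covariance_mx X.

Lemma sqnorm_le_max i : inner (col i X) (col i X) <= r.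
Proof.
have -> : inner (col i X) (col i X) = l2norm (col i X) ^+ 2.
  by rewrite /l2norm sqr_sqrtr // inner_ge0.
exact: le_bigmax_cond.
Qed.

Lemma tr_covariance_mx : A^T = A.
Proof.
rewrite /A /covariance_mx linearZ /= raddf_sum /=; congr (_ *: _).
by apply: eq_bigr => i _; rewrite trmx_mul trmxK.
Qed.

Lemma covariance_mulE (w : 'cV[R]_d) :
  A *m w = n%:R^-1 *: \sum_j (inner (col j X) w *: col j X).
Proof.
rewrite /A /covariance_mx -scalemxAl mulmx_suml; congr (_ *: _).
apply: eq_bigr => j _; rewrite -mulmxA.
rewrite [(col j X)^T *m w]mx11_scalar scalar_mxC mul_scalar_mx.
by [].
Qed.

Lemma inner_covariance (u w : 'cV[R]_d) :
  inner u (A *m w) = n%:R^-1 * \sum_j (inner (col j X) w * inner (col j X) u).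
Proof.
rewrite covariance_mulE innerZr inner_sumr; congr (_ * _).
by apply: eq_bigr => j _; rewrite innerZr (innerC u).
Qed.

Lemma col_inner_le (i : 'I_n) (u w : 'cV[R]_d) : inner u u = 1 -> inner w w = 1 ->
  `|inner (col i X) w * inner (col i X) u| <= r.
Proof.
move=> u1 w1; have := inner_CauchySchwarz (col i X) u.
have := inner_CauchySchwarz (col i X) w; rewrite u1 w1 !mulr1.
have := sqnorm_le_max i; move: (inner _ (col i X)) (inner _ u) (inner _ w) => a b c.
move=> ar cr br; rewrite ler_norml; apply/andP; split; nra.
Qed.

Lemma inner_covariance_le (u w : 'cV[R]_d) : (0 < n)%N ->
  inner u u = 1 -> inner w w = 1 -> `|inner u (A *m w)| <= r.
Proof.
move=> n0 u1 w1; rewrite inner_covariance; apply: mean_le => // j.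
exact: col_inner_le.
Qed.

(** On an eigenvector the quadratic form of [A] is both [z] times a positive number and a mean of
    squares. This later bounds the gap by the top eigenvalue. *)
Lemma spectrum_ge0 (s : seq R) z : (0 < n)%N ->
  ordered_spectrum A s -> z \in s -> 0 <= z.
Proof.
move=> n0 [_ chA] zs; have : root (char_poly A) z by rewrite chA root_prod_XsubC.
rewrite -eigenvalue_root_char => /eigenvalueP[u uA u0].
have uu : 0 < inner u^T u^T.
  by rewrite lt_def inner_ge0 inner_eq0 trmx_eq0 u0.
have : inner u^T (A *m u^T) = z * inner u^T u^T.
  rewrite -innerZr; congr (inner _ _).
  by have := congr1 trmx uA; rewrite trmx_mul tr_covariance_mx linearZ.
move=> e; rewrite -(pmulr_lge0 _ uu) -e inner_covariance mulr_ge0 //.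
by apply: sumr_ge0 => j _; rewrite -expr2 sqr_ge0.
Qed.

End Covariance.

(* The division is eliminated through 1 / D >= 2 - D for D > 0. *)
Lemma normalized_sq_ge (R : realFieldType) (a b q N rho : R) :
  `|a| <= 1 -> `|b| <= 3 * rho -> `|q| <= 3 * rho -> 0 <= N <= 9 * rho ^+ 2 ->
  6 * rho <= 1 -> 0 < 1 + 2 * q + N ->
  a ^+ 2 + 2 * (a * b - a ^+ 2 * q) - 66 * rho ^+ 2 <=
  (a + b) ^+ 2 / (1 + 2 * q + N).
Proof.
rewrite !ler_norml => /andP[a1 a2] /andP[b1 b2] /andP[q1 q2] /andP[N1 N2] rho1 D0.
have rho0 : 0 <= rho by lra.
have inv : (a + b) ^+ 2 * (1 - 2 * q - N) <= (a + b) ^+ 2 / (1 + 2 * q + N).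
  apply: ler_wpM2l; first exact: sqr_ge0.
  rewrite -(ler_pM2r D0) mulVf ?gt_eqF //.
  have -> : (1 - 2 * q - N) * (1 + 2 * q + N) = 1 - (2 * q + N) ^+ 2 by ring.
  by rewrite gerBl sqr_ge0.
apply: (le_trans _ inv).
(* From [rho <= 1/6] follows [|a + b| <= 3/2]. *)
have ab : (a + b) ^+ 2 <= 9 / 4 by nra.
have Nab : N * (a + b) ^+ 2 <= 9 * rho ^+ 2 * (9 / 4).
  by apply: ler_pM => //; exact: sqr_ge0.
have c_bound : `|2 * (a * b) + b ^+ 2| <= 15 / 2 * rho.
  have -> : 2 * (a * b) + b ^+ 2 = b * (2 * a + b) by ring.
  rewrite normrM.
  have -> : 15 / 2 * rho = (3 * rho) * (5 / 2) by field.
  by apply: ler_pM => //; rewrite ler_norml; apply/andP; split; lra.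
have qc : `|q * (2 * (a * b) + b ^+ 2)| <= 3 * rho * (15 / 2 * rho).
  by rewrite normrM; apply: ler_pM => //; rewrite ler_norml q1.
(* The discarded terms are at most [81/4 rho^2] (from [N]) and [45 rho^2] (from [q]), in total
   [65.25 rho^2], and the leftover [b^2] is nonnegative. Hence the constant [66]. *)
have := ler_norm (q * (2 * (a * b) + b ^+ 2)).
have := sqr_ge0 b; have := sqr_ge0 rho.
move=> h1 h2 h3; nra.
Qed.

Lemma sqnormDZ (R : realType) d (u v : 'cV[R]_d) k :
  inner (u + k *: v) (u + k *: v) =
  inner u u + 2 * (k * inner u v) + k ^+ 2 * inner v v.
Proof.
rewrite innerDr innerZr (innerC _ u) (innerC _ v) !innerDr !innerZr (innerC v u).
ring.
Qed.

(** * One normalized stochastic step *)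

Section Step.
Variables (R : realType) (d n : nat) (X : 'M[R]_(d, n)) (eta : R).
Let r := max_sqnorm X.
Let A := covariance_mx X.

(** The variance-reduced direction, with the mean [ut] of [vrpca_step] written as [A *m wt]. *)
Definition vrpca_grad (wt : 'cV[R]_d) (i : 'I_n) (w : 'cV[R]_d) : 'cV[R]_d :=
  (inner (col i X) w - inner (col i X) wt) *: col i X + A *m wt.

Lemma inner_grad u wt i w : inner u (vrpca_grad wt i w) =
  inner (col i X) w * inner (col i X) u - inner (col i X) wt * inner (col i X) u
  + inner u (A *m wt).
Proof. by rewrite /vrpca_grad innerDr innerZr (innerC u (col i X)) mulrBl. Qed.

Hypothesis n_gt0 : (0 < n)%N.

(** The two terms in [wt] cancel on average: the reference point affects the fluctuation but not the
    mean. *)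
Lemma mean_inner_grad u wt w :
  n%:R^-1 * \sum_i inner u (vrpca_grad wt i w) = inner u (A *m w).
Proof.
under eq_bigr do rewrite inner_grad.
rewrite big_split /= sumrB sumr_const card_ord !inner_covariance.
set a := \sum_i _; set b := \sum_i _.
rewrite -[X in a - b + X]mulr_natl mulrA mulfV ?pnatr_eq0 -?lt0n // mul1r.
by rewrite subrK.
Qed.

Lemma inner_grad_le u wt i w : inner u u = 1 -> inner wt wt = 1 -> inner w w = 1 ->
  `|inner u (vrpca_grad wt i w)| <= 3 * r.
Proof.
move=> u1 wt1 w1; rewrite inner_grad.
have := col_inner_le X i u1 w1; have := col_inner_le X i u1 wt1.
have := inner_covariance_le X n_gt0 u1 wt1.
rewrite -/r -/A !ler_norml => /andP[? ?] /andP[? ?] /andP[? ?].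
by apply/andP; split; lra.
Qed.

(** Testing the direction against its own normalization reduces this to [inner_grad_le]. *)
Lemma sqnorm_grad_le wt i w : inner wt wt = 1 -> inner w w = 1 ->
  inner (vrpca_grad wt i w) (vrpca_grad wt i w) <= 9 * r ^+ 2.
Proof.
move=> wt1 w1; set g := vrpca_grad _ _ _; have g0 := inner_ge0 g.
have [e|gn0] := eqVneq (inner g g) 0.
  by rewrite e mulr_ge0 // sqr_ge0.
pose N := Num.sqrt (inner g g).
have NN : inner g g = N ^+ 2 by rewrite sqr_sqrtr.
have N0 : 0 < N by rewrite sqrtr_gt0 lt_def gn0.
have u1 : inner (N^-1 *: g) (N^-1 *: g) = 1.
  by rewrite innerZr innerC innerZr NN; field; rewrite gt_eqF.
have := inner_grad_le i u1 wt1 w1; rewrite -/g innerC innerZr NN.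
have -> : N^-1 * N ^+ 2 = N by field; rewrite gt_eqF.
rewrite gtr0_norm // => Nr.
have -> : 9 * r ^+ 2 = (3 * r) ^+ 2 by ring.
by rewrite ler_sqr ?nnegrE //; [exact: ltW|exact: le_trans (ltW N0) Nr].
Qed.

Hypotheses (eta_ge0 : 0 <= eta) (eta_r : 6 * (eta * r) <= 1).

Lemma vrpca_stepE wt i w : vrpca_step X eta wt i w =
  (l2norm (w + eta *: vrpca_grad wt i w))^-1 *: (w + eta *: vrpca_grad wt i w).
Proof. by rewrite /vrpca_step /= /vrpca_grad covariance_mulE. Qed.

Lemma sqnorm_preimage wt i w : inner w w = 1 ->
  inner (w + eta *: vrpca_grad wt i w) (w + eta *: vrpca_grad wt i w) =
  1 + 2 * (eta * inner w (vrpca_grad wt i w))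
              + eta ^+ 2 * inner (vrpca_grad wt i w) (vrpca_grad wt i w).
Proof.
by move=> w1; rewrite sqnormDZ w1.
Qed.

(** Normalization needs a nonzero vector. The squared norm is [(1 + eta q)^2 + eta^2 (N - q^2)],
    where [|eta q| <= 1/2], and [q^2 <= N] by Cauchy-Schwarz. *)
Lemma sqnorm_preimage_gt0 wt i w : inner wt wt = 1 -> inner w w = 1 ->
  
  0 < inner (w + eta *: vrpca_grad wt i w) (w + eta *: vrpca_grad wt i w).
Proof.
move=> wt1 w1; rewrite sqnorm_preimage //.
set q := inner w _; set N := inner _ (vrpca_grad _ _ _).
have q2 : q ^+ 2 <= N.
  by apply: (le_trans (inner_CauchySchwarz _ _)); rewrite w1 mul1r.
have : `|eta * q| <= 1 / 2.
  rewrite normrM ger0_norm //.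
  have := ler_wpM2l eta_ge0 (inner_grad_le i w1 wt1 w1); rewrite -/q.
  by move: eta_r; move: (eta * `|q|) => z; lra.
rewrite ler_norml => /andP[h1 h2].
have : 0 <= eta ^+ 2 * (N - q ^+ 2) by rewrite mulr_ge0 ?sqr_ge0 // subr_ge0.
move=> h3.
have : 0 < (1 + eta * q) ^+ 2 by rewrite exprn_gt0 //; lra.
by nra.
Qed.

Lemma step_unit wt i w : inner wt wt = 1 -> inner w w = 1 ->
  inner (vrpca_step X eta wt i w) (vrpca_step X eta wt i w) = 1.
Proof.
move=> wt1 w1; rewrite vrpca_stepE.
have := sqnorm_preimage_gt0 i wt1 w1; rewrite /= /l2norm; set y := w + _ => y0.
rewrite innerZr innerC innerZr -{3}(sqr_sqrtr (ltW y0)); field.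
by rewrite gt_eqF // sqrtr_gt0.
Qed.

(** This is [normalized_sq_ge] with [rho = eta r], applied to the components of the scaled direction
    along [v] and along [w]. *)
Lemma step_progress v wt i w : inner v v = 1 -> inner wt wt = 1 -> inner w w = 1 ->
  inner v w ^+ 2 + 2 * eta * (inner v w * inner v (vrpca_grad wt i w)
     - inner v w ^+ 2 * inner w (vrpca_grad wt i w)) - 66 * (eta * r) ^+ 2
  <= inner v (vrpca_step X eta wt i w) ^+ 2.
Proof.
move=> v1 wt1 w1; rewrite vrpca_stepE innerZr [leRHS]exprMn.
have y0 := sqnorm_preimage_gt0 i wt1 w1.
rewrite exprVn /l2norm (sqr_sqrtr (ltW y0)); move: y0.
rewrite /= sqnorm_preimage // innerDr innerZr [_^-1 * _]mulrC.
have := inner_grad_le i v1 wt1 w1; have := inner_grad_le i w1 wt1 w1.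
have := sqnorm_grad_le i wt1 w1; have := inner_ge0 (vrpca_grad wt i w).
have := inner_CauchySchwarz v w; rewrite v1 w1 mul1r.
set g := vrpca_grad wt i w.
move: (inner v w) (inner v g) (inner w g) (inner g g) => a b q N a1 N0 Nr qr br D0.
have scale (z : R) : `|z| <= 3 * r -> `|eta * z| <= 3 * (eta * r).
  by move=> zr; rewrite normrM ger0_norm // mulrCA ler_wpM2l.
have -> : 2 * eta * (a * b - a ^+ 2 * q) =
    2 * (a * (eta * b) - a ^+ 2 * (eta * q)) by ring.
apply: normalized_sq_ge => //; try exact: scale.
  by rewrite -ler_sqr ?nnegrE // expr1n real_normK ?num_real.
rewrite mulr_ge0 ?sqr_ge0 //= exprMn mulrCA.
by rewrite ler_wpM2l ?sqr_ge0.
Qed.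

(** The first-order term of [step_progress] minus its mean over the draw. That mean does not involve
    [wt] and later supplies the drift. *)
Definition vrpca_noise (v wt w : 'cV[R]_d) (i : 'I_n) : R :=
  2 * eta * (inner v w * inner v (vrpca_grad wt i w)
     - inner v w ^+ 2 * inner w (vrpca_grad wt i w)
     - (inner v w * inner v (A *m w) - inner v w ^+ 2 * inner w (A *m w))).

Lemma sum_noise v wt w : \sum_i vrpca_noise v wt w i = 0.
Proof.
rewrite -mulr_sumr sumrB sumrB -!mulr_sumr sumr_const card_ord.
have E u : \sum_i inner u (vrpca_grad wt i w) = n%:R * inner u (A *m w).
  by rewrite -(mean_inner_grad u wt w) mulrA mulfV ?mul1r // pnatr_eq0 -lt0n.
by rewrite -[X in _ - X]mulr_natl !E; ring.
Qed.

Lemma noise_le v wt w i : inner v v = 1 -> inner wt wt = 1 -> inner w w = 1 ->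
  `|vrpca_noise v wt w i| <= 16 * (eta * r).
Proof.
move=> v1 wt1 w1; rewrite /vrpca_noise.
have := inner_grad_le i v1 wt1 w1; have := inner_grad_le i w1 wt1 w1.
have := inner_covariance_le X n_gt0 v1 w1; have := inner_covariance_le X n_gt0 w1 w1.
have := inner_CauchySchwarz v w; rewrite v1 w1 mul1r -/A -/r.
set g := vrpca_grad wt i w.
move: (inner v w) (inner v (A *m w)) (inner w (A *m w)) => a e f.
move: (inner v g) (inner w g) => b q a1 fr er qr br.
have a1' : `|a| <= 1 by rewrite -ler_sqr ?nnegrE // expr1n real_normK ?num_real.
have sc (k z B : R) : `|k| <= 1 -> `|z| <= B -> `|k * z| <= B.
  by move=> k1 zB; rewrite normrM -[B]mul1r ler_pM.
have a2 : `|a ^+ 2| <= 1 by rewrite ger0_norm ?sqr_ge0.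
have := sc _ _ _ a1' br; have := sc _ _ _ a2 qr; have := sc _ _ _ a1' er.
have := sc _ _ _ a2 fr.
move: (a * b) (a ^+ 2 * q) (a * e) (a ^+ 2 * f) => x y z t.
rewrite -mulrA normrM (ger0_norm (_ : 0 <= 2)) // normrM ger0_norm //.
move=> h1 h2 h3 h4.
(* Two terms of size [3 r] and two of size [r]; the prefactor [2 * eta] then gives [16]. *)
have : `|x - y - (z - t)| <= 8 * r.
  move: h1 h2 h3 h4; rewrite !ler_norml => /andP[? ?] /andP[? ?] /andP[? ?] /andP[? ?].
  by apply/andP; split; lra.
by move/(ler_wpM2l eta_ge0); lra.
Qed.

End Step.

(** * The iterates as one sequence across epochs *)

Section Iterates.
Variables (R : realType) (d n : nat) (X : 'M[R]_(d, n)) (eta : R) (m : nat).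
Variable w0 : 'cV[R]_d.
Hypothesis m_gt0 : (0 < m)%N.

Definition vrpca_ref (i : nat -> 'I_n) (t : nat) : 'cV[R]_d :=
  vrpca_epoch X eta m w0 i (t %/ m).

(** When [t.+1] is a multiple of [m], [vrpca] is already in the next epoch with no inner step made.
    The start of that epoch is the result of inner step [m] of epoch [t %/ m], so the recursion
    holds across the boundary too. *)
Lemma vrpcaS i t : vrpca X eta m w0 i t.+1 =
  vrpca_step X eta (vrpca_ref i t) (i t) (vrpca X eta m w0 i t).
Proof.
rewrite /vrpca_ref /vrpca.
have [km|] := ltnP (t %% m).+1 m.
  have tE : t.+1 = (t %/ m * m + (t %% m).+1)%N by rewrite addnS -divn_eq.
  rewrite [in LHS]tE divnMDl // (divn_small km) addn0 modnMDl (modn_small km) /=.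
  by rewrite -divn_eq.
rewrite leq_eqVlt ltnNge ltn_mod m_gt0 orbF => /eqP mE.
have tE : t.+1 = ((t %/ m).+1 * m)%N.
  by rewrite [in LHS](divn_eq t m) mulSn -addnS -mE addnC.
rewrite [in LHS]tE mulnK // modnMl /=.
set f := fun _ => _.
have -> : vrpca_inner X eta (vrpca_epoch X eta m w0 i (t %/ m)) f m =
  vrpca_inner X eta (vrpca_epoch X eta m w0 i (t %/ m)) f (t %% m).+1 by rewrite -mE.
have fE : f (t %% m)%N = i t by rewrite /f -divn_eq.
by rewrite /= fE.
Qed.

Lemma vrpca_inner_ext wt f g t : (forall j, (j < t)%N -> f j = g j) ->
  vrpca_inner X eta wt f t = vrpca_inner X eta wt g t.
Proof.
elim: t => //= t IH fg; rewrite fg // IH // => j jt.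
by rewrite fg // ltnW.
Qed.

Lemma vrpca_epoch_ext f g s : (forall j, (j < s * m)%N -> f j = g j) ->
  vrpca_epoch X eta m w0 f s = vrpca_epoch X eta m w0 g s.
Proof.
elim: s => //= s IH fg; rewrite IH => [|j js]; last first.
  by rewrite fg // mulSn ltn_addl.
by apply: vrpca_inner_ext => t tm; rewrite fg // mulSn addnC ltn_add2r.
Qed.

(** Adaptedness: the reference point was fixed after [t %/ m * m] draws, which is at most [t]. *)
Lemma vrpca_ref_ext f g t : (forall j, (j < t)%N -> f j = g j) ->
  vrpca_ref f t = vrpca_ref g t.
Proof.
move=> fg; apply: vrpca_epoch_ext => j jt; apply: fg.
exact: leq_trans jt (leq_divM _ _).
Qed.

Lemma vrpca_ext f g t : (forall j, (j < t)%N -> f j = g j) ->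
  vrpca X eta m w0 f t = vrpca X eta m w0 g t.
Proof.
elim: t => [|t IH] fg; first by rewrite /vrpca div0n mod0n.
have fg' j : (j < t)%N -> f j = g j by move=> jt; rewrite fg // ltnW.
by rewrite !vrpcaS fg // IH // (vrpca_ref_ext fg').
Qed.

Hypotheses (n_gt0 : (0 < n)%N) (eta_ge0 : 0 <= eta).
Hypotheses (eta_r : 6 * (eta * max_sqnorm X) <= 1) (w0_unit : inner w0 w0 = 1).

Lemma vrpca_inner_unit wt f t : inner wt wt = 1 ->
  inner (vrpca_inner X eta wt f t) (vrpca_inner X eta wt f t) = 1.
Proof. by move=> wt1; elim: t => //= t IH; exact: step_unit. Qed.

Lemma vrpca_ref_unit f t : inner (vrpca_ref f t) (vrpca_ref f t) = 1.
Proof.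
rewrite /vrpca_ref; elim: (t %/ m)%N => //= s IH; exact: vrpca_inner_unit.
Qed.

Lemma vrpca_unit f t :
  inner (vrpca X eta m w0 f t) (vrpca X eta m w0 f t) = 1.
Proof. by apply: vrpca_inner_unit; exact: vrpca_ref_unit. Qed.

End Iterates.

(* M is the summed noise and beta the bias per step; up to these, p is
   nondecreasing, which is what the potential q below records. *)
Lemma logistic_growth (R : realType) (p M : nat -> R) (T : nat) (zeta kappa beta : R) :
  0 < zeta <= 1 -> 0 <= kappa -> 0 <= beta ->
  (forall t, (t <= T)%N -> 0 <= p t <= 1) -> zeta <= p 0%N ->
  M 0%N = 0 -> (forall t, (t <= T)%N -> `|M t| <= zeta / 8) ->
  T%:R * beta <= zeta / 8 ->
  (forall t, (t < T)%N ->
    p t + kappa * (p t * (1 - p t)) + (M t.+1 - M t) - beta <= p t.+1) ->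
  20 < T%:R * kappa * zeta -> 1 / 2 <= p T.
Proof.
move=> /andP[z0 z1] k0 b0 p01 p0 M0 MT Tb pS Tk.
pose q t := p t - M t + t%:R * beta.
have qS t : (t < T)%N -> q t + kappa * (p t * (1 - p t)) <= q t.+1.
  by move=> tT; have := pS _ tT; rewrite /q -natr1 mulrDl mul1r; lra.
have qmono s t : (s <= t)%N -> (t <= T)%N -> q s <= q t.
  elim: t => [|t IH]; first by rewrite leqn0 => /eqP ->.
  rewrite leq_eqVlt => /orP[/eqP -> //|st] tT.
  apply: (le_trans (IH st (ltnW tT))); apply: le_trans (qS _ tT).
  have /andP[pt0 pt1] := p01 _ (ltnW tT).
  by rewrite lerDl !mulr_ge0 // subr_ge0.
have tb t : (t <= T)%N -> 0 <= t%:R * beta <= zeta / 8.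
  move=> tT; rewrite mulr_ge0 //=; apply: le_trans Tb.
  by rewrite ler_wpM2r // ler_nat.
have Mb t : (t <= T)%N -> - (zeta / 8) <= M t <= zeta / 8.
  by move=> tT; rewrite -ler_norml MT.
have [[s sT ps]|no] := pselect (exists2 s, (s <= T)%N & 7 / 8 <= p s).
  (* From level [7/8] the loss is at most [2 zeta / 8] through [M] and [zeta / 8] through the bias;
     [zeta <= 1] leaves [1/2]. *)
  have := qmono _ _ sT (leqnn T); rewrite /q.
  have /andP[] := tb _ sT; have /andP[] := tb _ (leqnn T).
  have /andP[] := Mb _ sT; have /andP[] := Mb _ (leqnn T).
  by move: (T%:R * beta) (s%:R * beta) => x y; lra.
have small t : (t <= T)%N -> p t < 7 / 8.
  by move=> tT; rewrite ltNge; apply/negP => h; apply: no; exists t.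
have big t : (t <= T)%N -> zeta / 2 <= p t.
  move=> tT; have := qmono _ _ (leq0n t) tT; rewrite /q M0 mul0r.
  have /andP[] := tb _ tT; have /andP[] := Mb _ tT.
  by move: (t%:R * beta) => x; lra.
have qlin t : (t <= T)%N -> q 0%N + t%:R * (kappa * zeta / 16) <= q t.
  elim: t => [|t IH] tT; first by rewrite mul0r addr0.
  apply: le_trans (qS _ tT); rewrite -natr1 mulrDl mul1r addrA.
  apply: lerD; first exact: IH (ltnW tT).
  have := big _ (ltnW tT); have := small _ (ltnW tT).
  move: (p t) => x x1 x2.
  rewrite -mulrA ler_wpM2l //.
  have : zeta / 2 * (1 / 8) <= x * (1 - x) by apply: ler_pM; lra.
  lra.
(* Contradiction: [q T <= 1 + zeta / 4 <= 5/4], while [qlin] makes it exceed [20/16]. *)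
have := qlin _ (leqnn T); rewrite /q M0 mul0r.
have /andP[] := tb _ (leqnn T); have /andP[] := Mb _ (leqnn T).
have /andP[] := p01 _ (leqnn T).
have -> : T%:R * (kappa * zeta / 16) = T%:R * kappa * zeta / 16 by ring.
by move: (T%:R * beta) (T%:R * kappa * zeta) Tk => x y; lra.
Qed.

(** * Events determined by finitely many draws *)

Section PrefixEvents.
Variables (disp : measure_display) (Omega : measurableType disp) (n : nat).
Variable I : nat -> Omega -> 'I_n.
Hypothesis I_meas : forall t (j : 'I_n), measurable (I t @^-1` [set j]).

(** Induction on the number of draws: splitting by the value of the last draw and freezing it leaves
    a predicate of the earlier draws only. *)
Lemma measurable_prefix k (Q : (nat -> 'I_n) -> Prop) :
  (forall f g, (forall j, (j < k)%N -> f j = g j) -> Q f -> Q g) ->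
  measurable [set omega | Q (I^~ omega)].
Proof.
elim: k Q => [|k IH] Q Qk.
  (* With no draw to depend on, [Q] is constant, so the event is full or empty. *)
  have [[w Qw]|noQ] := pselect (exists w, Q (I^~ w)).
    rewrite (_ : [set _ | _] = setT); first exact: measurableT.
    by apply/seteqP; split=> // x _ /=; apply: Qk Qw.
  rewrite (_ : [set _ | _] = set0); first exact: measurable0.
  by apply/seteqP; split=> // x /= Qx; apply: noQ; exists x.
pose upd (f : nat -> 'I_n) i t := if t == k then i else f t.
rewrite (_ : [set _ | _] = \bigcup_(i in [set: 'I_n])
    ((I k @^-1` [set i]) `&` [set w | Q (upd (I^~ w) i)])).
  apply: fin_bigcup_measurable => // i _; apply: measurableI; first exact: I_meas.
  apply: (IH (fun f => Q (upd f i))) => f g fg; apply: Qk => j.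
  by rewrite ltnS leq_eqVlt /upd; case: eqP => //= _ /fg.
apply/seteqP; split=> [w /= Qw|w [i _ [/= Ii Qi]]].
  exists (I k w) => //; split=> //=; apply: Qk Qw => j _.
  by rewrite /upd; case: eqP => // ->.
by apply: Qk Qi => j _; rewrite /upd; case: eqP => // ->.
Qed.

End PrefixEvents.

(** * Maximal inequality for the noise *)

Section MaximalInequality.
Variables (R : realType) (disp : measure_display) (Omega : measurableType disp).
Variables (P : probability Omega R) (n : nat) (I : nat -> Omega -> 'I_n).
Hypotheses (n_gt0 : (0 < n)%N) (I_iid : iid_uniform_draws P I).

Lemma prob_cylinder (h : nat -> 'I_n) k :
  P [set omega | forall j, (j < k)%N -> I j omega = h j] = (n%:R^-1 ^+ k)%:E.
Proof.
have [_ unif indep] := I_iid.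
pose J := [fset x in iota 0 k]%fset.
have := indep J (fun t => [set h t]).
rewrite (_ : \bigcap_(_ in _) _ =
    [set omega | forall j, (j < k)%N -> I j omega = h j]); last first.
  apply/seteqP; split=> w /= Hw j; last first.
    by rewrite /= inE mem_iota /= add0n => jk; exact: Hw.
  by move=> jk; apply: Hw; rewrite /= inE mem_iota.
move=> ->; under eq_bigr do rewrite unif.
rewrite prodEFin; congr (_%:E).
rewrite big_const_seq count_predT.
have -> : size J = k by rewrite card_imfset //= undup_id ?iota_uniq // size_iota.
by elim: (k) => //= k' ->; rewrite exprS.
Qed.

Variables (D : nat -> (nat -> 'I_n) -> 'I_n -> R) (B : R).
Hypothesis D_adapted : forall t f g, (forall j, (j < t)%N -> f j = g j) ->
  D t f = D t g.
Hypothesis D_mean0 : forall t f, \sum_i D t f i = 0.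
Hypothesis D_bound : forall t f i, `|D t f i| <= B.

(** A martingale along the draws: [D k] sees only the draws before [k] and averages to zero over
    draw [k]. *)
Definition partial_noise (f : nat -> 'I_n) t : R := \sum_(k < t) D k f (f k).

Lemma partial_noise_ext f g t : (forall j, (j < t)%N -> f j = g j) ->
  partial_noise f t = partial_noise g t.
Proof.
move=> fg; apply: eq_bigr => k _; rewrite fg // (D_adapted (g := g)) // => j jk.
by rewrite fg // (ltn_trans jk).
Qed.

(** Here [k] draws are fixed and [l] remain; fixing one more draw moves the start of the window to
    [k.+1] and keeps its end. *)
Let exceeds (e : R) k l f :=
  exists2 t, (k <= t <= k + l)%N & e < `|partial_noise f t|.

Let measurable_cyl (e : R) k l (h : nat -> 'I_n) :
  measurable [set w | (forall j, (j < k)%N -> I j w = h j) /\ exceeds e k l (I^~ w)].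
Proof.
have [I_meas _ _] := I_iid.
apply: (measurable_prefix I_meas (k := k + l)
  (Q := fun f => (forall j, (j < k)%N -> f j = h j) /\ exceeds e k l f)).
move=> f g fg [fh [t tkl et]]; split=> [j jk|].
  by rewrite -fg ?fh // ltn_addr.
exists t => //; rewrite -(partial_noise_ext (f := f)) // => j jt.
by apply: fg; case/andP: tkl => _ /(leq_trans jt).
Qed.

Let P_union (F : 'I_n -> set Omega) (S : set Omega) :
  measurable S -> (forall i, measurable (F i)) ->
  S `<=` [set w | exists i, F i w] -> (P S <= \sum_(i < n) P (F i))%E.
Proof.
move=> Sm Fm SF.
(* The family is padded with empty sets because [content_subadditive] is indexed by naturals. *)
pose F' k := if insub k is Some i then F i else set0.
have F'E (i : 'I_n) : F' i = F i by rewrite /F' valK.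
under eq_bigr do rewrite -F'E.
apply: content_subadditive => //.
  by move=> k _; rewrite /F'; case: insub.
move=> w /SF[i Fw]; rewrite -bigcup_mkord; exists (nat_of_ord i) => /=.
  exact: ltn_ord.
by rewrite F'E.
Qed.

(* Conditioning on the next draw: once the walk has crossed the level the bound
   exceeds 1, and otherwise its value squared grows by at most B^2 on average. *)
Lemma walk_maximal_inequality_cylinder (e : R) l k h : 0 < e ->
  (P [set w | (forall j, (j < k)%N -> I j w = h j) /\ exceeds e k l (I^~ w)] <=
   (n%:R^-1 ^+ k * ((partial_noise h k ^+ 2 + l%:R * B ^+ 2) / e ^+ 2))%:E)%E.
Proof.
move=> e0; have [I_meas _ _] := I_iid.
have cyl_meas k' (g : nat -> 'I_n) :
    measurable [set w | forall j, (j < k')%N -> I j w = g j].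
  apply: (measurable_prefix I_meas (k := k')
    (Q := fun f => forall j, (j < k')%N -> f j = g j)).
  by move=> f g' fg fh j jk; rewrite -fg // fh.
have n1 : (0 : R) < n%:R^-1 by rewrite invr_gt0 ltr0n.
have crossed l' k' h' : e < `|partial_noise h' k'| ->
    (P [set w | (forall j, (j < k')%N -> I j w = h' j) /\ exceeds e k' l' (I^~ w)] <=
    (n%:R^-1 ^+ k' * ((partial_noise h' k' ^+ 2 + l'%:R * B ^+ 2) / e ^+ 2))%:E)%E.
  move=> big.
  apply: (@le_trans _ _ (P [set w | forall j, (j < k')%N -> I j w = h' j])).
    apply: le_measure; rewrite ?inE; [exact: measurable_cyl|exact: cyl_meas|].
    by move=> w [].
  rewrite prob_cylinder lee_fin ler_peMr ?exprn_ge0 ?(ltW n1) //.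
  rewrite ler_pdivlMr ?exprn_gt0 // mul1r.
  apply: ler_wpDr; first by rewrite mulr_ge0 ?ler0n // sqr_ge0.
  by rewrite -[leRHS]real_normK ?num_real // ler_sqr ?nnegrE // ltW.
elim: l k h => [|l IH] k h; (have [|small] := ltP e `|partial_noise h k|;
  first exact: crossed).
- rewrite (_ : [set _ | _] = set0).
    rewrite measure0 lee_fin mulr_ge0 ?exprn_ge0 ?(ltW n1) //.
    by rewrite divr_ge0 ?sqr_ge0 // mul0r addr0 sqr_ge0.
  apply/seteqP; split=> // w /= [wh [t]].
  rewrite addn0 -eqn_leq => /eqP <-.
  by rewrite (partial_noise_ext wh) ltNge small.
pose upd i t := if t == k then i else h t.
have updk i : upd i k = i by rewrite /upd eqxx.
have updh i j : (j < k)%N -> upd i j = h j.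
  by rewrite /upd => jk; rewrite ltn_eqF.
apply: le_trans (P_union (F := fun i => [set w |
   (forall j, (j < k.+1)%N -> I j w = upd i j) /\ exceeds e k.+1 l (I^~ w)]) _ _ _) _.
- exact: measurable_cyl.
- by move=> i; exact: measurable_cyl.
- move=> w /= [wh [t tk et]]; exists (I k w); split.
    move=> j; rewrite ltnS leq_eqVlt => /orP[/eqP ->|jk]; first by rewrite updk.
    by rewrite updh // wh.
  exists t => //; rewrite addSnnS; case/andP: tk => tk ->; rewrite andbT.
  (* By [small] there is no crossing at time [k] itself, so the window may start at [k.+1]. *)
  rewrite ltn_neqAle tk andbT; apply/eqP => kt.
  by move: et; rewrite -kt (partial_noise_ext wh) ltNge small.
apply: (@le_trans _ _ (\sum_(i < n) (n%:R^-1 ^+ k.+1 *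
   ((partial_noise (upd i) k.+1 ^+ 2 + l%:R * B ^+ 2) / e ^+ 2))%:E)).
  by apply: lee_sum => i _; exact: IH.
rewrite sumEFin lee_fin -mulr_sumr exprSr -mulrA ler_wpM2l ?exprn_ge0 ?(ltW n1) //.
rewrite -mulr_suml [leLHS]mulrA ler_wpM2r ?invr_ge0 ?sqr_ge0 // ler_pdivrMl ?ltr0n //.
set M := partial_noise h k.
have ME i : partial_noise (upd i) k.+1 = M + D k h i.
  rewrite /partial_noise big_ord_recr /= updk; congr (_ + _).
    by apply: partial_noise_ext => j jk; rewrite updh.
  by rewrite (D_adapted (g := h)) // => j jk; rewrite updh.
(* The cross term sums to zero by [D_mean0] and [D_bound] caps the square, which accounts for one
   more [B ^+ 2]. *)
apply: (@le_trans _ _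
  (\sum_(i < n) (M ^+ 2 + 2 * M * D k h i + B ^+ 2 + l%:R * B ^+ 2))).
  apply: ler_sum => i _; rewrite ME lerD2r sqrrD -mulr_natl mulrA lerD2l.
  rewrite -[leLHS]real_normK ?num_real // ler_sqr ?nnegrE //.
  exact: le_trans (D_bound k h i).
rewrite !big_split /= -[X in _ + X + _ + _]mulr_sumr D_mean0 mulr0 addr0.
rewrite !sumr_const card_ord.
rewrite -!mulrnDl -[leLHS]mulr_natl -[l.+1%:R]natr1 ler_wpM2l //.
by rewrite mulrDl mul1r addrAC addrA.
Qed.

Lemma walk_maximal_inequality (e : R) T : 0 < e ->
  (P [set w | exists2 t, (t <= T)%N & (e < `|partial_noise (I^~ w) t|)%R] <=
   (T%:R * B ^+ 2 / e ^+ 2)%:E)%E.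
Proof.
(* No draw is fixed when [k = 0], so any history serves. *)
move=> e0; have := walk_maximal_inequality_cylinder T 0 (fun=> Ordinal n_gt0) e0.
rewrite expr0 mul1r {1}/partial_noise big_ord0 expr0n add0r.
congr (P _ <= _)%E; apply/seteqP; split=> w /=.
  by move=> [_ [t tT et]]; exists t; rewrite ?add0n in tT *.
by move=> [t tT et]; split=> //; exists t.
Qed.

Lemma measurable_exceeds (e : R) T :
  measurable [set w | exists2 t, (t <= T)%N & (e < `|partial_noise (I^~ w) t|)%R].
Proof.
have [I_meas _ _] := I_iid.
apply: (measurable_prefix I_meas (k := T) (Q := fun f =>
  exists2 t, (t <= T)%N & (e < `|partial_noise f t|)%R)).
move=> f g fg [t tT et]; exists t => //.
by rewrite -(partial_noise_ext (f := f)) // => j jt; rewrite fg // (leq_trans jt).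
Qed.

End MaximalInequality.

(** * Choice of constants *)

Lemma ln_2div_ge (R : realType) (delta : R) : 0 < delta < 1 / 2 ->
  3 / 4 <= ln (2 / delta).
Proof.
(* This is [ln x <= x - 1] at [x = delta / 2 < 1/4]. *)
move=> /andP[d0 d1]; have : ln (1 + (delta / 2 - 1)) <= delta / 2 - 1.
  by apply: le_ln1Dx; lra.
have -> : 1 + (delta / 2 - 1) = (2 / delta)^-1 by rewrite invf_div; ring.
by rewrite lnV ?posrE ?divr_gt0 //; lra.
Qed.

Section Scaling.
Variables (R : realType) (r lambda zeta delta eta : R).
(** The value is dictated by [failure_probability_le]; the other smallness conditions hold with
    ample room. *)
Let c : R := (64 * 64 * 64)^-1.
Let L := ln (2 / delta).
Let T := iteration_count 16 eta lambda zeta delta.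
Hypotheses (lambda_gt0 : 0 < lambda) (lambda_le : lambda <= r).
Hypotheses (zeta01 : 0 < zeta <= 1) (delta_bound : 0 < delta < 1 / 2).
Hypotheses (eta_gt0 : 0 < eta) (eta_le : eta <= step_bound c r lambda zeta delta).

Let c_gt0 : 0 < c. Proof. by rewrite invr_gt0; lra. Qed.
Let L_ge : 3 / 4 <= L. Proof. exact: ln_2div_ge. Qed.
Let r_gt0 : 0 < r. Proof. exact: lt_le_trans lambda_le. Qed.
Let zeta_gt0 : 0 < zeta. Proof. by case/andP: zeta01. Qed.
Let delta_gt0 : 0 < delta. Proof. by case/andP: delta_bound. Qed.
Let L_gt0 : 0 < L. Proof. by apply: lt_le_trans L_ge; lra. Qed.
Let elz_gt0 : 0 < eta * lambda * zeta. Proof. by rewrite !mulr_gt0. Qed.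

Let eta_key : eta * r ^+ 2 * L ^+ 2 <= c * (delta ^+ 2 * lambda * zeta ^+ 3).
Proof.
move: eta_le; rewrite /step_bound ler_pdivlMr ?mulr_gt0 ?exprn_gt0 //.
by rewrite !mulrA.
Qed.

(** Since [L^2 >= 9/16], [delta^2 <= 1/4], [lambda <= r] and [zeta <= 1], the step bound yields
    [eta r <= 4 c / 9] after division by [r]. *)
Lemma eta_r_le : 6 * (eta * r) <= 1.
Proof.
have /andP[_ z1] := zeta01; have /andP[_ d1] := delta_bound.
have h1 : delta ^+ 2 * lambda * zeta ^+ 3 <= 1 / 4 * r.
  rewrite -[leRHS]mulr1; apply: ler_pM; rewrite ?mulr_ge0 ?exprn_ge0 ?(ltW r_gt0)
    ?(ltW lambda_gt0) ?(ltW delta_gt0) ?(ltW zeta_gt0) //; last first.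
    by rewrite exprn_ile1 // ltW.
  by apply: ler_pM; rewrite ?sqr_ge0 ?(ltW lambda_gt0) //; move: delta_gt0; nra.
have h2 : eta * r ^+ 2 * (9 / 16) <= eta * r ^+ 2 * L ^+ 2.
  have L2 : 9 / 16 <= L ^+ 2 by have := L_ge; move: L => l; nra.
  by rewrite ler_wpM2l // mulr_ge0 ?sqr_ge0 // ltW.
have h3 : c * (delta ^+ 2 * lambda * zeta ^+ 3) <= c * (1 / 4 * r).
  by rewrite ler_wpM2l // ltW.
have h4 : (6 * (eta * r)) * r <= 1 * r.
  have := le_trans (le_trans h2 eta_key) h3; have := r_gt0.
  have -> : eta * r ^+ 2 = eta * r * r by ring.
  have -> : 6 * (eta * r) * r = 6 * (eta * r * r) by ring.
  by rewrite /c; move: (eta * r * r) => z; lra.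
by rewrite -(ler_pM2r r_gt0).
Qed.

Let elz_le : 6 * (eta * lambda * zeta) <= 1.
Proof.
have /andP[_ z1] := zeta01; apply: le_trans eta_r_le.
rewrite ler_wpM2l // -mulrA ler_wpM2l ?(ltW eta_gt0) //.
by apply: le_trans lambda_le; rewrite ger_pMr.
Qed.

Let T_bounds : T%:R * (eta * lambda * zeta) <= 16 * L < T.+1%:R * (eta * lambda * zeta).
Proof.
have x0 : 0 <= 16 * L / (eta * lambda * zeta).
  by apply: divr_ge0; [rewrite mulr_ge0 // ltW|exact: ltW].
have := truncn_itv x0.
by rewrite -/(iteration_count 16 eta lambda zeta delta) -/T ler_pdivlMr //
  ltr_pdivrMr.
Qed.

(** The floor costs at most [eta lambda zeta <= 1/6], so [T eta lambda zeta > 16 L - 1/6 >= 12 -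
    1/6]; twice this exceeds the [20] required by [logistic_growth]. *)
Lemma iterations_enough : 20 < T%:R * (2 * eta * lambda) * zeta.
Proof.
have /andP[_] := T_bounds; rewrite -natr1 mulrDl mul1r => h.
have -> : T%:R * (2 * eta * lambda) * zeta = 2 * (T%:R * (eta * lambda * zeta)).
  by ring.
by move: h elz_le L_ge; lra.
Qed.

(** Here [T] is at most [16 L / (eta lambda zeta)] and the step bound controls [eta r^2 L^2]. One
    factor [L] stays in the denominator, and [L >= 3/4] turns [16] into [64/3]. *)
Lemma total_variance_le :
  T%:R * (eta * r) ^+ 2 <= 64 / 3 * c * (delta ^+ 2 * zeta ^+ 2).
Proof.
have /andP[h _] := T_bounds.
have lz : 0 < L * (lambda * zeta) by rewrite !mulr_gt0.
rewrite -(ler_pM2r lz).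
have -> : T%:R * (eta * r) ^+ 2 * (L * (lambda * zeta)) =
  (T%:R * (eta * lambda * zeta)) * (eta * r ^+ 2 * L) by ring.
apply: (@le_trans _ _ (16 * L * (eta * r ^+ 2 * L))).
  by rewrite ler_wpM2r // !mulr_ge0 ?ltW ?exprn_gt0.
have -> : 16 * L * (eta * r ^+ 2 * L) = 16 * (eta * r ^+ 2 * L ^+ 2) by ring.
apply: (@le_trans _ _ (16 * (c * (delta ^+ 2 * lambda * zeta ^+ 3)))).
  by rewrite ler_wpM2l.
have -> : 64 / 3 * c * (delta ^+ 2 * zeta ^+ 2) * (L * (lambda * zeta)) =
  (64 / 3 * L) * (c * (delta ^+ 2 * lambda * zeta ^+ 3)) by ring.
rewrite ler_wpM2r //; last by move: L_ge; lra.
by rewrite !mulr_ge0 ?exprn_ge0 ?(ltW c_gt0) ?ltW.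
Qed.

Lemma bias_le : T%:R * (66 * (eta * r) ^+ 2) <= zeta / 8.
Proof.
have /andP[_ z1] := zeta01; have /andP[_ d1] := delta_bound.
have := total_variance_le.
rewrite [T%:R * (66 * _)]mulrCA; move: (T%:R * (eta * r) ^+ 2) => x; rewrite /c => h.
have h1 : delta ^+ 2 * zeta ^+ 2 <= 1 / 4 * zeta.
  have d2 : delta ^+ 2 <= 1 / 4 by move: delta_gt0; nra.
  have z2 : zeta ^+ 2 <= zeta by move: zeta_gt0; nra.
  by apply: ler_pM; rewrite ?sqr_ge0.
by move: zeta_gt0; lra.
Qed.

(** As [16^2 * 8^2 * (64/3) * c = 4/3], the left side is at most [(4/3) delta^2], which is below
    [delta] for [delta < 1/2]. *)
Lemma failure_probability_le :
  T%:R * (16 * (eta * r)) ^+ 2 / (zeta / 8) ^+ 2 <= delta.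
Proof.
have /andP[_ d1] := delta_bound.
rewrite ler_pdivrMr ?exprn_gt0 ?divr_gt0 // exprMn mulrCA.
have := total_variance_le; move: (T%:R * (eta * r) ^+ 2) => x; rewrite /c => h.
have h1 : delta ^+ 2 * zeta ^+ 2 <= (1 / 2 * delta) * zeta ^+ 2.
  rewrite ler_wpM2r ?sqr_ge0 //.
  by move: delta_gt0; nra.
have h2 : 0 <= delta * zeta ^+ 2 by rewrite mulr_ge0 ?sqr_ge0 // ltW.
by rewrite expr_div_n; lra.
Qed.

Lemma iteration_count_order a : 0 < a ->
  a * step_bound c r lambda zeta delta <= eta ->
  8 / c * (r ^+ 2 * L ^+ 3 / (delta ^+ 2 * lambda ^+ 2 * zeta ^+ 4)) <= T%:R <=
  16 / (c * a) * (r ^+ 2 * L ^+ 3 / (delta ^+ 2 * lambda ^+ 2 * zeta ^+ 4)).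
Proof.
move=> a0 aeta; set Q := r ^+ 2 * _ / _.
(* [Y] is [c] times the ratio of [eta] to its upper bound, hence lies between [c a] and [c]; the
   order of [T] is read off from [QY]. *)
pose Y := eta * r ^+ 2 * L ^+ 2 / (delta ^+ 2 * lambda * zeta ^+ 3).
have den : 0 < delta ^+ 2 * lambda * zeta ^+ 3 by rewrite !mulr_gt0 ?exprn_gt0.
have Yc : Y <= c by rewrite ler_pdivrMr.
have acY : c * a <= Y.
  move: aeta; rewrite /step_bound mulrA ler_pdivrMr ?mulr_gt0 ?exprn_gt0 //.
  rewrite /Y ler_pdivlMr // => aeta'.
  have -> : c * a * (delta ^+ 2 * lambda * zeta ^+ 3) =
    a * (c * delta ^+ 2 * lambda * zeta ^+ 3) by ring.
  by rewrite -[eta * _ * _]mulrA.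
have QY : Q * (eta * lambda * zeta) = L * Y.
  by rewrite /Q /Y; field; rewrite !gt_eqF.
have /andP[h1 h2] := T_bounds.
apply/andP; split; rewrite -(ler_pM2r elz_gt0) -[_ * Q * _]mulrA QY.
  (* Halving [16] to [8] pays for the floor, since [eta lambda zeta <= 1/6 <= 8 L]. *)
  have : 8 / c * (L * Y) <= 8 * L.
    have -> : 8 / c * (L * Y) = 8 * L * (Y / c) by field; rewrite gt_eqF.
    by rewrite ler_piMr ?mulr_ge0 ?(ltW L_gt0) // ler_pdivrMr // mul1r.
  move: h2; rewrite -natr1 mulrDl mul1r.
  by move: elz_le L_ge; move: (8 / c * (L * Y)) => z; lra.
apply: (le_trans h1).
have -> : 16 / (c * a) * (L * Y) = 16 * L * (Y / (c * a)).
  by field; rewrite !gt_eqF.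
by rewrite ler_peMr ?mulr_ge0 ?(ltW L_gt0) // ler_pdivlMr ?mulr_gt0 // mul1r.
Qed.

End Scaling.

(** * Consequences of the hypotheses on a run *)

Section Run.
Variables (R : realType) (d n : nat) (X : 'M[R]_(d, n)) (s : seq R) (lambda : R).
Variables (v1 w0 : 'cV[R]_d) (zeta delta : R) (m : nat) (c eta : R).
Hypothesis hyps : vrpca_hyps X s lambda v1 w0 zeta delta m c eta.

Lemma vrpca_hyps_facts :
  [/\ inner v1 v1 = 1, inner w0 w0 = 1, 0 < lambda <= max_sqnorm X &
      0 < zeta <= 1].
Proof.
have [[d1 n0] sp [sl l0] [Av /l2norm_eq1 v11]
  [/l2norm_eq1 w01 /andP[z0 zle] _ _ _]] := hyps.
have sz : size s = d.
  have [_ chA] := sp.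
  by have := size_char_poly (covariance_mx X); rewrite chA size_prod_XsubC => -[].
split=> //; last first.
  rewrite z0 (le_trans zle) // (le_trans (inner_CauchySchwarz _ _)) //.
  by rewrite v11 w01 mulr1.
rewrite l0 -sl.
(* As [size s = d > 1], the second entry of [s] is a genuine eigenvalue. Being nonnegative, it
   bounds the gap by the first entry, the Rayleigh quotient of [v1], which is at most [r]. *)
have s1 : 0 <= s`_1.
  by apply: (spectrum_ge0 n0 sp); rewrite mem_nth // sz.
have := inner_covariance_le X n0 v11 v11; rewrite Av innerZr v11 mulr1 ler_norml.
by move=> /andP[_]; lra.
Qed.

(** With [a = inner v1 w], symmetry of the covariance makes the right side [a^2] times the top
    eigenvalue minus the Rayleigh quotient of [w]; by [rayleigh_gap] this difference is at least
    [lambda (1 - a^2)]. *)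
Lemma drift_ge w : inner w w = 1 ->
  lambda * (inner v1 w ^+ 2 * (1 - inner v1 w ^+ 2)) <=
  inner v1 w * inner v1 (covariance_mx X *m w) -
  inner v1 w ^+ 2 * inner w (covariance_mx X *m w).
Proof.
move=> w1; have [v11 _ _ _] := vrpca_hyps_facts.
have [[d1 n0] sp [sl l0] [Av _] _] := hyps.
have -> : inner v1 (covariance_mx X *m w) = s`_0 * inner v1 w.
  rewrite inner_covariance; under eq_bigr do rewrite mulrC.
  by rewrite -inner_covariance Av innerZr innerC.
have s10 : s`_1 < s`_0 by move: l0; rewrite -sl; lra.
have := rayleigh_gap d1 (tr_covariance_mx X) sp s10 Av v11 w1.
rewrite -sl; move: (inner v1 w) (inner w _) => a q h.
have := ler_wpM2l (sqr_ge0 a) h; lra.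
Qed.

End Run.

(** * Assembly of the probability bound and the order of the iteration count *)

Theorem theorem2 (R : realType) :
  exists c c' : R, [/\ 0 < c, 0 < c',
    forall (d n : nat) (X : 'M[R]_(d, n)) (s : seq R) (lambda : R)
      (v1 w0 : 'cV[R]_d) (zeta delta : R) (m : nat) (eta : R),
      vrpca_hyps X s lambda v1 w0 zeta delta m c eta ->
      let T := iteration_count c' eta lambda zeta delta in
      forall (disp : measure_display) (Omega : measurableType disp)
        (P : probability Omega R) (I : nat -> Omega -> 'I_n),
        iid_uniform_draws P I ->
        ((1 - delta)%:E <=
         P [set omega |
              (1 - inner v1 (vrpca X eta m w0 (fun t => I t omega) T) ^+ 2
               <= 1 / 2)%R])%E
  & forall a : R, 0 < a ->
    exists C1 C2 : R, [/\ 0 < C1, 0 < C2 &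
      forall (d n : nat) (X : 'M[R]_(d, n)) (s : seq R) (lambda : R)
        (v1 w0 : 'cV[R]_d) (zeta delta : R) (m : nat) (eta : R),
        vrpca_hyps X s lambda v1 w0 zeta delta m c eta ->
        let r := max_sqnorm X in
        let T := iteration_count c' eta lambda zeta delta in
        let Q := r ^+ 2 * ln (2 / delta) ^+ 3
                 / (delta ^+ 2 * lambda ^+ 2 * zeta ^+ 4) in
        a * step_bound c r lambda zeta delta <= eta ->
        C1 * Q <= T%:R <= C2 * Q]].
Proof.
have c_gt0 : 0 < (64 * 64 * 64)^-1 :> R by rewrite invr_gt0; lra.
exists (64 * 64 * 64)^-1, 16; split=> //; last first.
  move=> a a0; exists (8 / (64 * 64 * 64)^-1), (16 / ((64 * 64 * 64)^-1 * a)).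
  split; rewrite ?divr_gt0 ?mulr_gt0 //.
  move=> d n X s lambda v1 w0 zeta delta m eta hyps r T Q aeta.
  have [_ _ /andP[l0 lr] z01] := vrpca_hyps_facts hyps.
  have [_ _ _ _ [_ _ d01 _ /andP[eta0 eta_le]]] := hyps.
  exact: iteration_count_order.
move=> d n X s lambda v1 w0 zeta delta m eta hyps T disp Omega P I iid.
have [v11 w01 /andP[l0 lr] z01] := vrpca_hyps_facts hyps.
have [[_ n0] _ _ _ [_ /andP[z0 zle] d01 m0 /andP[eta0 eta_le]]] := hyps.
have eta_ge0 := ltW eta0.
have eta_r := eta_r_le l0 lr z01 d01 eta0 eta_le.
pose w f t := vrpca X eta m w0 f t.
pose ref f t := vrpca_ref X eta m w0 f t.
have w_unit f t : inner (w f t) (w f t) = 1 by exact: vrpca_unit.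
have ref_unit f t : inner (ref f t) (ref f t) = 1 by exact: vrpca_ref_unit.
pose D t f := vrpca_noise X eta v1 (ref f t) (w f t).
have D_adapted t f g : (forall j, (j < t)%N -> f j = g j) -> D t f = D t g.
  by move=> fg; rewrite /D /ref /w (vrpca_ref_ext _ _ _ _ fg) (vrpca_ext _ _ _ m0 fg).
have D_mean0 t f : \sum_i D t f i = 0 by exact: sum_noise.
have D_bound t f i : `|D t f i| <= 16 * (eta * max_sqnorm X) by exact: noise_le.
have e0 : 0 < zeta / 8 by rewrite divr_gt0.
pose bad := [set omega | exists2 t, (t <= T)%N &
  zeta / 8 < `|partial_noise D (I^~ omega) t|].
have bad_meas : measurable bad by exact: (measurable_exceeds iid D_adapted).
have bad_le : (P bad <= delta%:E)%E.
  apply: le_trans (walk_maximal_inequality n0 iid D_adapted D_mean0 D_bound T e0) _.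
  by rewrite lee_fin; exact: failure_probability_le.
have good omega : ~ bad omega ->
    1 - inner v1 (vrpca X eta m w0 (I^~ omega) T) ^+ 2 <= 1 / 2.
  move=> nbad; set f := I^~ omega.
  suff : 1 / 2 <= inner v1 (w f T) ^+ 2 by rewrite /w; lra.
  apply: (@logistic_growth _ (fun t => inner v1 (w f t) ^+ 2) (partial_noise D f)
    T zeta (2 * eta * lambda) (66 * (eta * max_sqnorm X) ^+ 2)) => //.
  - by rewrite !mulr_ge0 // ltW.
  - by rewrite mulr_ge0 // sqr_ge0.
  - move=> t _; rewrite sqr_ge0 /= (le_trans (inner_CauchySchwarz _ _)) //.
    by rewrite v11 w_unit mulr1.
  - by rewrite /w /vrpca div0n mod0n.
  - by rewrite /partial_noise big_ord0.
  - by move=> t tT; rewrite leNgt; apply/negP => et; apply: nbad; exists t.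
  - exact: bias_le.
  - move=> t tT /=.
    have -> : w f t.+1 = vrpca_step X eta (ref f t) (f t) (w f t) by exact: vrpcaS.
    have := step_progress n0 eta_ge0 eta_r (f t) v11 (ref_unit f t) (w_unit f t).
    apply: le_trans; rewrite lerD2r.
    have -> : partial_noise D f t.+1 - partial_noise D f t = D t f (f t).
      by rewrite /partial_noise big_ord_recr /= addrAC subrr add0r.
    (* The first-order term of [step_progress] is [D] plus its mean, and [drift_ge] bounds the mean;
       this is where the rate [2 * eta * lambda] arises. *)
    have := ler_wpM2l eta_ge0 (drift_ge hyps (w_unit f t)).
    by rewrite /D /vrpca_noise; lra.
  - exact: (iterations_enough l0 lr z01 d01 eta0 eta_le).
have -> : (1 - delta)%:E = (1 - delta%:E)%E by rewrite EFinB.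
apply: (@le_trans _ _ (P (~` bad))).
  by rewrite probability_setC // leeB.
apply: le_measure; rewrite ?inE //.
- exact: measurableC.
(* Success is decided by the first [T] draws, hence is a measurable event. *)
- have [I_meas _ _] := iid.
  apply: (measurable_prefix I_meas (k := T) (Q := fun f =>
    1 - inner v1 (vrpca X eta m w0 f T) ^+ 2 <= 1 / 2)).
  by move=> f g fg; rewrite (vrpca_ext _ _ _ m0 fg).
Qed.
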